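(* Let $E$ be a pseudo effect algebra satisfying (RDP)$_2$. Then the state space $\mathcal S(E)$ is either empty or a nonempty Bauer simplex.
   Context: A pseudo effect algebra is a partial algebra $(E;+,0,1)$, with $+$ a partial binary operation and $0,1$ constants, such that for all $a,b,c\in E$: (i) $a+b$ and $(a+b)+c$ exist iff $b+c$ and $a+(b+c)$ exist, and then $(a+b)+c=a+(b+c)$; (ii) there are exactly one $d\in E$ and exactly one $e\in E$ with $a+d=e+a=1$; (iii) if $a+b$ exists, there are $d,e\in E$ with $a+b=d+a=b+e$; (iv) if $1+a$ or $a+1$ exists, then $a=0$. The order is $a\le b$ iff there is $c\in E$ with $a+c=b$. (RDP)$_2$: for all $a_1,a_2,b_1,b_2\in E$ with $a_1+a_2=b_1+b_2$ there are $d_1,d_2,d_3,d_4\in E$ with $d_1+d_2=a_1$, $d_3+d_4=a_2$, $d_1+d_3=b_1$, $d_2+d_4=b_2$ and $d_2\wedge d_3=0$. A state on $E$ is a map $s:E\to[0,1]$ with $s(a+b)=s(a)+s(b)$ whenever $a+b$ is defined and $s(1)=1$; $\mathcal S(E)$ is the convex set of all states with the topology of pointwise (weak) convergence, viewed in the locally convex space $\mathbb R^E$. A convex cone in a real vector space $V$ is a subset $C$ containing $0$ and closed under linear combinations with nonnegative coefficients; it is strict if $C\cap(-C)=\{0\}$, and then $x\le_C y$ iff $y-x\in C$ is a partial order. A lattice cone is a strict convex cone $C$ that is a lattice under $\le_C$. A base for a convex cone $C$ is a convex subset $K\subseteq C$ such that every nonzero $y\in C$ is uniquely of the form $y=\alpha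 x$ with $\alpha\ge0$ real, $x\in K$. A simplex is a convex subset of a real vector space that is affinely isomorphic (via a bijection preserving convex combinations in both directions) to a base for a lattice cone in some real vector space. A Bauer simplex is a simplex $K$ in a locally convex Hausdorff space such that both $K$ and its set of extreme points $\partial_e K$ are compact. *)

(* Defs.v *)
From HB Require Import structures.
From mathcomp Require Import all_boot all_order all_algebra.
From mathcomp Require Import all_classical all_reals all_analysis.
From mathcomp Require Import ring.
Set Implicit Arguments.
Unset Strict Implicit.
Unset Printing Implicit Defensive.
Import Order.TTheory GRing.Theory Num.Theory.
Import numFieldNormedType.Exports.
Local Open Scope classical_set_scope.
Local Open Scope ring_scope.

(* The library gives {ptws E -> R} its topology only; the vector space and
   locally convex structures of R^E are added here. *)

HB.instance Definition _ (R : realType) (E : Type) :=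
  GRing.Lmodule.copy {ptws E -> R^o} (E -> R^o).

Section ptws_tvs.
Context {R : realType} {E : Type}.
Local Notation V := {ptws E -> R^o}.

Lemma ptws_cvgP (F : set_system V) (f : V) : Filter F ->
  F --> f <-> forall x, (fun g : V => g x) @ F --> (f x : R^o).
Proof.
move=> FF; split=> [/cvg_sup Ff x|Ff].
  move: (Ff x) => {}Ff U; rewrite /= nbhsE => -[W [oW Wfx] WU].
  apply: (@filterS _ F _ ((fun g : V => g x) @^-1` W)); first by move=> g /WU.
  apply: Ff; apply: open_nbhs_nbhs; by split => //; exists W.
apply/cvg_sup => x; apply/cvg_image.
  by rewrite -subTset => y _; exists (fun=> y).
move=> U /Ff FU; exists ((fun g : V => g x) @^-1` U) => //.
by rewrite image_preimage// -subTset => y _; exists (fun=> y).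
Qed.

Lemma ptws_eval_continuous (x : E) : continuous (fun g : V => g x : R^o).
Proof. by move=> f; have [+ _] := ptws_cvgP f (nbhs_filter f); apply. Qed.

Let ptws_add_continuous : continuous (fun z : V * V => z.1 + z.2).
Proof.
move=> [f g].
rewrite /continuous_at/=.
have FF : Filter ((fun z : V * V => z.1 + z.2) @ nbhs (f, g)).
  exact: fmap_filter.
apply: (proj2 (@ptws_cvgP ((fun z : V * V => z.1 + z.2) @ nbhs (f, g))
                          (f + g) FF)) => x.
have fx : (fun z : V * V => z.1 x : R^o) @ nbhs (f, g) --> (f x : R^o).
  apply: (@cvg_comp _ _ _ (fun z : V * V => z.1) (fun h : V => h x) _ (nbhs f)).
    exact: cvg_fst.
  exact: ptws_eval_continuous.
have gx : (fun z : V * V => z.2 x : R^o) @ nbhs (f, g) --> (g x : R^o).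
  apply: (@cvg_comp _ _ _ (fun z : V * V => z.2) (fun h : V => h x) _ (nbhs g)).
    exact: cvg_snd.
  exact: ptws_eval_continuous.
exact: (@cvgD _ _ _ _ _ _ _ _ _ fx gx).
Qed.

Let ptws_scale_continuous : continuous (fun z : R^o * V => z.1 *: z.2).
Proof.
move=> [k f].
rewrite /continuous_at/=.
have FF : Filter ((fun z : R^o * V => z.1 *: z.2) @ nbhs (k, f)).
  exact: fmap_filter.
apply: (proj2 (@ptws_cvgP ((fun z : R^o * V => z.1 *: z.2) @ nbhs (k, f))
                          (k *: f) FF)) => x.
have kx : (fun z : R^o * V => z.1 : R^o) @ nbhs (k, f) --> (k : R^o).
  exact: cvg_fst.
have fx : (fun z : R^o * V => z.2 x : R^o) @ nbhs (k, f) --> (f x : R^o).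
  apply: (@cvg_comp _ _ _ (fun z : R^o * V => z.2) (fun h : V => h x) _ (nbhs f)).
    exact: cvg_snd.
  exact: ptws_eval_continuous.
exact: (@cvgZ _ _ _ _ _ _ _ _ _ kx fx).
Qed.

Let ptws_locally_convex :
  exists2 B : set_system V, (forall b, b \in B -> convex_set b) & basis B.
Proof.
exists [set U | open U /\ convex_set U] => [U /set_mem[]//|].
split=> [U []//|f].
pose G := filter_from [set U : set V | [/\ open U, convex_set U & U f]] id.
have GF : Filter G.
  apply: filter_from_filter.
    by exists setT; split => //; exact: openT.
  move=> A B [oA cA Af] [oB cB Bf]; exists (A `&` B) => //; split => //.
    exact: openI.
  move=> g h l /set_mem[/mem_set Ag /mem_set Bg] /set_mem[/mem_set Ah /mem_set Bh].
  by apply/mem_set; split; apply/set_mem; [exact: cA|exact: cB].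
have Gf : G --> f.
  apply/ptws_cvgP => x U /nbhs_ballP[e /= e0 eU].
  exists ((fun g : V => g x) @^-1` (ball (f x) e)) => [|g]; last exact: eU.
  split; last exact: ballxx.
    by apply: open_comp => [g _|]; [exact: ptws_eval_continuous|exact: ball_open].
  move=> g h l; rewrite !inE -ball_normE /= => fg fh.
  rewrite [X in `|X|](_ : _ =
      l%:num * (f x - g x) + (1 - l%:num) * (f x - h x)); last first.
    rewrite [X in _ - X](_ : _ = l%:num * g x + (1 - l%:num) * h x)//.
    by ring.
  have l0 : 0 <= l%:num by [].
  have l1 : 0 <= 1 - l%:num by rewrite subr_ge0.
  rewrite (le_lt_trans (ler_normD _ _))// !normrM (ger0_norm l0) (ger0_norm l1).
  have [->|ln0] := eqVneq l%:num 0; first by rewrite mul0r add0r subr0 mul1r.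
  have {ln0} lgt0 : 0 < l%:num by rewrite lt_neqAle eq_sym ln0.
  rewrite (_ : e = l%:num * e + (1 - l%:num) * e); last by ring.
  by apply: ltr_leD; [rewrite ltr_pM2l|exact/ler_wpM2l/ltW].
by move=> U /Gf[W [oW cW Wf] WU]; exists W.
Qed.

HB.instance Definition _ := PreTopologicalNmodule_isTopologicalNmodule.Build
  V ptws_add_continuous.
HB.instance Definition _ := TopologicalNmodule_isTopologicalLmodule.Build
  R V ptws_scale_continuous.
HB.instance Definition _ := Uniform_isTvs.Build R V ptws_locally_convex.
End ptws_tvs.

Record pseudoEffectAlgebra := PseudoEffectAlgebra {
  pea_sort :> Type;
  (* [padd a b = Some c] means that a + b is defined and equal to c *)
  padd : pea_sort -> pea_sort -> option pea_sort;
  pzero : pea_sort;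
  pone : pea_sort;
  (* both sides are defined simultaneously, and then they are equal *)
  paddA : forall a b c,
    obind (fun d => padd d c) (padd a b) = obind (fun d => padd a d) (padd b c);
  pcompl : forall a,
    (exists! d, padd a d = Some pone) /\ (exists! e, padd e a = Some pone);
  pconj : forall a b c, padd a b = Some c ->
    exists d e, padd d a = Some c /\ padd b e = Some c;
  pone_max : forall a, padd pone a <> None \/ padd a pone <> None -> a = pzero
}.
Arguments pzero {_}.
Arguments pone {_}.

Definition is_join {T : Type} (le : T -> T -> Prop) (D : set T) (x y z : T) :=
  [/\ D z, le x z, le y z & forall w, D w -> le x w -> le y w -> le z w].

Definition is_meet {T : Type} (le : T -> T -> Prop) (D : set T) (x y z : T) :=
  [/\ D z, le z x, le z y & forall w, D w -> le w x -> le w y -> le w z].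

Section pea.
Context {E : pseudoEffectAlgebra}.

Definition pea_le (a b : E) := exists c, padd a c = Some b.

Definition RDP2 := forall a1 a2 b1 b2 c : E,
  padd a1 a2 = Some c -> padd b1 b2 = Some c ->
  exists d1 d2 d3 d4 : E,
    [/\ padd d1 d2 = Some a1, padd d3 d4 = Some a2,
        padd d1 d3 = Some b1, padd d2 d4 = Some b2
      & is_meet pea_le setT d2 d3 pzero].

Definition is_state {R : realType} (s : E -> R) :=
  [/\ forall a, 0 <= s a <= 1,
      forall a b c, padd a b = Some c -> s c = s a + s b
    & s pone = 1].

End pea.
Arguments RDP2 : clear implicits.

Definition state_space (R : realType) (E : pseudoEffectAlgebra) :
    set {ptws E -> R^o} :=
  [set s | is_state s].
Arguments state_space : clear implicits.

Section cones.
Context {R : realType} {V : lmodType R}.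
Implicit Types (C K : set V) (x y : V).

Definition convex_cone C :=
  C 0 /\ forall (a b : R) x y, 0 <= a -> 0 <= b -> C x -> C y ->
    C (a *: x + b *: y).

Definition strict_cone C := C `&` [set - x | x in C] = [set 0].

Definition cone_le C x y := C (y - x).

Definition lattice_cone C :=
  [/\ convex_cone C, strict_cone C
    & forall x y, C x -> C y ->
        (exists z, is_join (cone_le C) C x y z) /\
        (exists z, is_meet (cone_le C) C x y z)].

Definition cone_base C K :=
  [/\ convex_set K, K `<=` C
    & forall y, C y -> y <> 0 ->
        exists! p : R * V, [/\ 0 <= p.1, K p.2 & y = p.1 *: p.2]].

Definition extreme_points K : set V :=
  [set x | K x /\ forall y z (t : R), K y -> K z -> 0 < t < 1 ->
    x = t *: y + (1 - t) *: z -> y = x /\ z = x].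

End cones.

Definition preserves_convex_combinations {R : realType} {V W : lmodType R}
    (K : set V) (f : V -> W) :=
  forall x y (t : R), K x -> K y -> 0 <= t <= 1 ->
    f (t *: x + (1 - t) *: y) = t *: f x + (1 - t) *: f y.

Definition affinely_isomorphic {R : realType} {V W : lmodType R}
    (K : set V) (L : set W) :=
  exists (f : V -> W) (g : W -> V),
    [/\ set_fun K L f, set_fun L K g,
        {in K, cancel f g} & {in L, cancel g f}] /\
    preserves_convex_combinations K f /\ preserves_convex_combinations L g.

Definition simplex {R : realType} {V : lmodType R} (K : set V) :=
  convex_set K /\
  exists (W : lmodType R) (C L : set W),
    [/\ lattice_cone C, cone_base C L & affinely_isomorphic K L].

Definition bauer_simplex {R : realType} {V : tvsType R} (K : set V) :=
  [/\ hausdorff_space V, simplex K, compact K & compact (extreme_points K)].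

(* Main.v *)
Require Import Defs.
From mathcomp Require Import all_boot all_order all_algebra.
From mathcomp Require Import all_classical all_reals all_analysis.
From mathcomp Require Import lra.
Set Implicit Arguments.
Unset Strict Implicit.
Unset Printing Implicit Defensive.
Import Order.TTheory GRing.Theory Num.Theory.
Import numFieldNormedType.Exports.
Local Open Scope classical_set_scope.
Local Open Scope ring_scope.

(** The positive additive functions on [E] form a convex cone [C] in R^E, for
    which the states, normalised by [s 1 = 1], are a base. Riesz decomposition
    makes [C] a lattice cone (lemma [positive_additive_lattice]): the meet of
    [m] and [n] sends [a] to the infimum of [m x + n y] over [x + y = a]. It is
    additive although [+] is not commutative, because an additive function takes
    the same value on conjugate elements. Hence the state space is a simplex. It
    is compact, as a closed subset of the cube [0, 1]^E.

    It remains to see that the set of extreme states is closed. The point is that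
    a state [s] is extreme if and only if [s a = 0] or [s b = 0] whenever
    [a /\ b = 0] (lemma [extreme_pointsE]), and this condition is closed.

    If [s] is extreme and [a /\ b = 0], then the part of [s] carried by the
    multiples of [a] is an additive function below [s], hence a multiple of [s];
    it agrees with [s] at [a] and vanishes at [b]. Conversely, let [s] satisfy the
    condition and let [m <= s] be additive. Two disjoint members of [C] below a
    multiple of [s] cannot both be nonzero: this is where the disjointness
    provided by (RDP)_2 enters (lemma [disjointness_preserving_meet0]). Applied to
    the positive and negative parts of [m - m(1) s], this gives [m = m(1) s], so
    that [s] has no proper convex decomposition. *)

(** * Arithmetic of a pseudo effect algebra *)

Section pea_arithmetic.
Context {E : pseudoEffectAlgebra}.
Implicit Types a b c d x y : E.

Lemma padd_assocl a b c d x : padd a b = Some d -> padd d c = Some x ->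
  exists2 y, padd b c = Some y & padd a y = Some x.
Proof.
move=> abd dcx; have := paddA a b c; rewrite abd /= dcx.
by case: (padd b c) => //= y ayx; exists y.
Qed.

Lemma padd_assocr a b c d x : padd b c = Some d -> padd a d = Some x ->
  exists2 y, padd a b = Some y & padd y c = Some x.
Proof.
move=> bcd adx; have := paddA a b c; rewrite bcd /= adx.
by case: (padd a b) => //= y ycx; exists y.
Qed.

Lemma padd1_eq0 a b : padd pone a = Some b -> a = pzero.
Proof. by move=> ab; apply: pone_max; left; rewrite ab. Qed.

Lemma padda0 a : padd a pzero = Some a.
Proof.
have p10 : padd pone pzero = Some (pone : E).
  by have [[d [d1 _]] _] := pcompl (pone : E); rewrite -[X in padd _ X](padd1_eq0 d1).
have [_ [e [ea1 _]]] := pcompl a.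
have [y ay ey1] := padd_assocl ea1 p10.
have [[d [_ dU]] _] := pcompl e.
by rewrite ay -(dU _ ey1) -(dU _ ea1).
Qed.

Lemma padd0a a : padd pzero a = Some a.
Proof.
have p01 : padd pzero pone = Some (pone : E).
  have [_ [e [e1 _]]] := pcompl (pone : E).
  by rewrite -[X in padd X _](_ : e = pzero)//; apply: pone_max; right; rewrite e1.
have [[d [ad1 _]] _] := pcompl a.
have [y ay yd1] := padd_assocr ad1 p01.
have [_ [e [_ eU]]] := pcompl d.
by rewrite ay -(eU _ yd1) -(eU _ ad1).
Qed.

Lemma pea_le_refl a : pea_le a a.
Proof. by exists pzero; exact: padda0. Qed.

Lemma pea_le_trans a b c : pea_le a b -> pea_le b c -> pea_le a c.
Proof. by move=> [x ax] [y byc]; have [z _ ?] := padd_assocl ax byc; exists z. Qed.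

Lemma pea_leP a b : pea_le a b <-> exists c, padd c a = Some b.
Proof.
split=> -[c abc]; have [d [e [da cb]]] := pconj abc; first by exists d.
by exists e.
Qed.

Lemma pea_le1 a : pea_le a pone.
Proof. by have [[d [ad _]] _] := pcompl a; exists d. Qed.

Lemma pea_le0 a : pea_le a pzero -> a = pzero.
Proof.
move=> [c ac]; have [d ad _] := padd_assocr ac (padda0 pone).
exact: padd1_eq0 ad.
Qed.

(** Conjugating [x2] past [y1] costs nothing to an additive function, whence the
    equation that relates [x2] and its conjugate [z]. *)
Lemma padd_exchange x1 y1 x2 y2 a b c :
    padd x1 y1 = Some a -> padd x2 y2 = Some b -> padd a b = Some c ->
  exists z x y, [/\ exists2 u, padd y1 x2 = Some u & padd z y1 = Some u,
    padd x1 z = Some x, padd y1 y2 = Some y & padd x y = Some c].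
Proof.
move=> xya xyb abc.
have [t y1b x1t] := padd_assocl xya abc.
have [u y1x2 uy2] := padd_assocr xyb y1b.
have [z [_ [zy1 _]]] := pconj y1x2.
have [y y1y2 zy] := padd_assocl zy1 uy2.
have [x x1z xy] := padd_assocr zy x1t.
by exists z, x, y; split=> //; exists u.
Qed.

Lemma pea_le_add x1 x2 a b c :
    pea_le x1 a -> pea_le x2 b -> padd a b = Some c ->
  exists2 x, padd x1 x2 = Some x & pea_le x c.
Proof.
move=> /pea_leP[y1 y1x1] [y2 x2y2] abc.
have [t x1b y1t] := padd_assocl y1x1 abc.
have [x x1x2 xy2] := padd_assocr x2y2 x1b.
exists x => //; apply: (@pea_le_trans _ t); first by exists y2.
by apply/pea_leP; exists y1.
Qed.

Lemma RDP2_le_add (hE : RDP2 E) x a b c : padd a b = Some c -> pea_le x c ->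
  exists x1 x2, [/\ pea_le x1 a, pea_le x2 b & padd x1 x2 = Some x].
Proof.
move=> abc [y xyc]; have [d1 [d2 [d3 [d4 [d12 d34 d13 d24 _]]]]] := hE _ _ _ _ _ abc xyc.
by exists d1, d3; split=> //; [exists d2|exists d4].
Qed.

(** Stands for the elements below some multiple of [a], although the multiples
    of [a] need not exist in [E]. *)
Inductive sum_below a : E -> Prop :=
| sum_below_le x : pea_le x a -> sum_below a x
| sum_below_add x y z :
    padd x y = Some z -> sum_below a x -> sum_below a y -> sum_below a z.

Lemma sum_below_down (hE : RDP2 E) a x y :
  sum_below a y -> pea_le x y -> sum_below a x.
Proof.
move=> ay; elim: ay x => [{}y ya x xy|y1 y2 {}y yE _ IH1 _ IH2 x xy].
  by apply: sum_below_le; exact: pea_le_trans ya.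
have [x1 [x2 [xy1 xy2 xE]]] := RDP2_le_add hE yE xy.
by apply: sum_below_add xE _ _; [exact: IH1|exact: IH2].
Qed.

Lemma sum_below_disjoint a b x : is_meet pea_le setT a b pzero ->
  sum_below a x -> pea_le x b -> x = pzero.
Proof.
move=> [_ _ _ ab0]; elim=> [{}x xa xb|x1 x2 {}x xE _ IH1 _ IH2 xb].
  by apply: pea_le0; exact: ab0.
have x10 : x1 = pzero by apply: IH1; apply: pea_le_trans xb; exists x2.
have x20 : x2 = pzero.
  by apply: IH2; apply: pea_le_trans xb; apply/pea_leP; exists x1.
by move: xE; rewrite x10 x20 padda0 => -[].
Qed.

End pea_arithmetic.

(** * The cone of positive additive functions *)

Section positive_additive.
Context {R : realType} {E : pseudoEffectAlgebra}.
Local Notation V := {ptws E -> R^o}.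
Implicit Types (m n p q s : V) (a b c x y : E).

Definition positive_additive : set V := [set m | (forall a, 0 <= (m a : R)) /\
  forall a b c, padd a b = Some c -> m c = m a + m b].

Lemma ptwsD m n a : (m + n) a = m a + n a. Proof. by []. Qed.
Lemma ptwsB m n a : (m - n) a = m a - n a. Proof. by []. Qed.
Lemma ptwsZ (k : R) m a : (k *: m) a = k * m a. Proof. by []. Qed.

Lemma positive_additive0 m : positive_additive m -> m pzero = 0.
Proof. by move=> [_ mD]; have := mD _ _ _ (padda0 pzero); lra. Qed.

Lemma positive_additive_le m a b :
  positive_additive m -> pea_le a b -> (m a : R) <= m b.
Proof. by move=> [m0 mD] [c /mD ->]; rewrite lerDl. Qed.

Lemma positive_additive_eq0 m : positive_additive m -> m pone = 0 -> m = 0.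
Proof.
move=> mP m1; apply/funext => a; apply/eqP; rewrite eq_le.
have [m0 _] := mP; rewrite [X in _ && X]m0 andbT -[X in _ <= X]m1.
exact/positive_additive_le/pea_le1.
Qed.

Lemma positive_additive_cone : convex_cone positive_additive.
Proof.
split; first by split=> // a b c _; rewrite [RHS]addr0.
move=> k l m n k0 l0 [m0 mD] [n0 nD]; split=> [a|a b c abc].
  by rewrite ptwsD !ptwsZ addr_ge0// mulr_ge0.
by rewrite !ptwsD !ptwsZ (mD _ _ _ abc) (nD _ _ _ abc); lra.
Qed.

Lemma positive_additiveD m n :
  positive_additive m -> positive_additive n -> positive_additive (m + n).
Proof.
move=> mP nP; rewrite -[m]scale1r -[n]scale1r.
exact: (proj2 positive_additive_cone).
Qed.

Lemma positive_additiveZ (k : R) m :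
  0 <= k -> positive_additive m -> positive_additive (k *: m).
Proof.
move=> k0 mP; rewrite -[X in positive_additive X]addr0 -[X in _ + X](scale0r m).
exact: (proj2 positive_additive_cone).
Qed.

Lemma positive_additiveB m n : positive_additive m -> positive_additive n ->
  (forall a, (n a : R) <= m a) -> positive_additive (m - n).
Proof.
move=> [_ mD] [_ nD] nm; split=> [a|a b c abc]; first by rewrite ptwsB subr_ge0.
by rewrite !ptwsB (mD _ _ _ abc) (nD _ _ _ abc); lra.
Qed.

Lemma positive_additive_strict : strict_cone positive_additive.
Proof.
apply/seteqP; split=> m /=; last first.
  move=> ->; have C0 := proj1 positive_additive_cone.
  by split=> //; exists 0; rewrite ?oppr0.
move=> [[m0 _] [n [n0 _] nm]]; apply/funext => a; apply/eqP.
rewrite eq_le [X in _ && X]m0 andbT -nm.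
by rewrite [X in X <= _](_ : _ = - n a)// oppr_le0.
Qed.

Lemma cone_leP m n : positive_additive m -> positive_additive n ->
  cone_le positive_additive m n <-> forall a, (m a : R) <= n a.
Proof.
move=> mP nP; split=> [[mn0 _] a|mn]; last exact: positive_additiveB.
by have := mn0 a; rewrite ptwsB subr_ge0.
Qed.

Definition additive_meet m n : V :=
  fun a => inf [set r : R | exists x y, padd x y = Some a /\ r = m x + n y].

Section meet.
Variables m n : V.
Hypotheses (mP : positive_additive m) (nP : positive_additive n).

Lemma additive_meet_le x y a : padd x y = Some a ->
  (additive_meet m n a : R) <= m x + n y.
Proof.
move=> xya; apply: ge_inf; last by exists x, y.
exists 0 => _ [z [t [_ ->]]].
by rewrite addr_ge0//; [exact: (proj1 mP)|exact: (proj1 nP)].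
Qed.

Lemma le_additive_meet (r : R) a :
  (forall x y, padd x y = Some a -> r <= m x + n y) ->
  r <= additive_meet m n a.
Proof.
move=> rP; apply: lb_le_inf; last by move=> _ [x [y [/rP + ->]]].
by exists (m a + n pzero), a, pzero; rewrite padda0.
Qed.

Lemma additive_meet_ltP a (e : R) : 0 < e -> exists x y,
  padd x y = Some a /\ (m x + n y : R) < additive_meet m n a + e.
Proof.
move=> e0; apply: contrapT => /forallNP H.
suff : (additive_meet m n a + e : R) <= additive_meet m n a by lra.
apply: le_additive_meet => x y xya.
have /forallNP/(_ y)/not_andP[//|/negP] := H x.
by rewrite -leNgt.
Qed.

(** The Riesz decomposition property refines a decomposition of [a + b] into
    decompositions of [a] and of [b]; conversely the latter combine, up to
    conjugation, into one of [a + b]. *)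
Lemma additive_meetP (hE : RDP2 E) : positive_additive (additive_meet m n).
Proof.
have [m0 mD] := mP; have [n0 nD] := nP.
split=> [a|a b c abc].
  by apply: le_additive_meet => x y _; exact: addr_ge0.
apply/eqP; rewrite eq_le; apply/andP; split.
  rewrite -lerBlDr; apply: le_additive_meet => x1 y1 xya.
  rewrite lerBlDr -lerBlDl; apply: le_additive_meet => x2 y2 xyb.
  have [z [x [y [[u yxu zyu] x1z yyy xyc]]]] := padd_exchange xya xyb abc.
  have := additive_meet_le xyc.
  have := mD _ _ _ yxu; rewrite (mD _ _ _ zyu).
  by rewrite (mD _ _ _ x1z) (nD _ _ _ yyy); lra.
apply: le_additive_meet => x y xyc.
have [d1 [d2 [d3 [d4 [d12 d34 d13 d24 _]]]]] := hE _ _ _ _ _ abc xyc.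
have := additive_meet_le d12; have := additive_meet_le d34.
by rewrite (mD _ _ _ d13) (nD _ _ _ d24); lra.
Qed.

Lemma additive_meet_lel a : (additive_meet m n a : R) <= m a.
Proof.
by have := additive_meet_le (padda0 a); rewrite (positive_additive0 nP); lra.
Qed.

Lemma additive_meet_ler a : (additive_meet m n a : R) <= n a.
Proof.
by have := additive_meet_le (padd0a a); rewrite (positive_additive0 mP); lra.
Qed.

End meet.

(** The ambient space is a vector space, so the join can be obtained from the
    meet [w] as [m + n - w]. *)
Lemma positive_additive_lattice (hE : RDP2 E) : lattice_cone positive_additive.
Proof.
split; [exact: positive_additive_cone|exact: positive_additive_strict|].
move=> m n mP nP; have wP := additive_meetP mP nP hE.
have [_ mD] := mP; have [_ nD] := nP.
set w := additive_meet m n in wP *.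
have wm : forall a, (w a : R) <= m a := additive_meet_lel mP nP.
have wn : forall a, (w a : R) <= n a := additive_meet_ler mP nP.
split.
  have vP : positive_additive (m + n - w).
    apply: positive_additiveB => // [|a]; first exact: positive_additiveD.
    by rewrite ptwsD; have := wm a; have := (proj1 nP) a; lra.
  exists (m + n - w); split=> //.
  - by apply/cone_leP => // a; rewrite ptwsB ptwsD; have := wn a; lra.
  - by apply/cone_leP => // a; rewrite ptwsB ptwsD; have := wm a; lra.
  move=> u uP /(cone_leP mP uP) mu /(cone_leP nP uP) nu.
  apply/cone_leP => // a; rewrite ptwsB ptwsD.
  suff : (m a + n a - u a : R) <= w a by lra.
  (* u a = u x + u y dominates n x + m y for each decomposition a = x + y *)
  apply: le_additive_meet => x y xya.
  rewrite (mD _ _ _ xya) (nD _ _ _ xya) ((proj2 uP) _ _ _ xya).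
  by have := nu x; have := mu y; lra.
exists w; split=> //; [exact/cone_leP|exact/cone_leP|].
move=> u uP /(cone_leP uP mP) um /(cone_leP uP nP) un.
apply/cone_leP => // a; apply: le_additive_meet => x y xya.
by rewrite ((proj2 uP) _ _ _ xya); have := um x; have := un y; lra.
Qed.

(** * States *)

Lemma stateP s : state_space R E s <-> positive_additive s /\ s pone = 1.
Proof.
split=> [[s01 sD s1]|[sP s1]].
  by split=> //; split=> // a; have /andP[] := s01 a.
split=> //; last by case: sP.
move=> a; rewrite (proj1 sP) /= -[X in _ <= X]s1.
exact/positive_additive_le/pea_le1.
Qed.

Lemma state_space_segment s t (k : R) : state_space R E s -> state_space R E t ->
  0 <= k <= 1 -> state_space R E (k *: s + (1 - k) *: t).
Proof.
move=> /stateP[sP s1] /stateP[tP t1] /andP[k0 k1]; apply/stateP; split.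
  by apply: (proj2 positive_additive_cone) => //; rewrite subr_ge0.
by rewrite ptwsD !ptwsZ s1 t1; lra.
Qed.

Lemma state_space_convex : convex_set (state_space R E).
Proof.
move=> s t k /set_mem sS /set_mem tS; apply/mem_set.
by apply: (state_space_segment sS tS); rewrite ge0 le1.
Qed.

Lemma state_space_base : cone_base positive_additive (state_space R E).
Proof.
split; [exact: state_space_convex|by move=> s /stateP[]|].
move=> m mP mN0; have m1N0 : m pone != 0 :> R.
  by apply/eqP => m1; exact/mN0/positive_additive_eq0.
exists (m pone, (m pone : R)^-1 *: m); split=> /= [|[k s] /= [_ /stateP[_ s1] mE]].
  split; first exact: (proj1 mP).
    apply/stateP; split; last by rewrite ptwsZ mulVf.
    by apply: positive_additiveZ => //; rewrite invr_ge0; exact: (proj1 mP).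
  by rewrite scalerA divff// scale1r.
have m1 : m pone = k by rewrite mE ptwsZ s1 mulr1.
rewrite m1 in m1N0 *.
by rewrite mE scalerA mulVf// scale1r.
Qed.

Lemma state_space_simplex (hE : RDP2 E) : simplex (state_space R E).
Proof.
split; first exact: state_space_convex.
exists V, positive_additive, (state_space R E); split.
- exact: positive_additive_lattice.
- exact: state_space_base.
- by exists idfun, idfun; split.
Qed.

(** * Extreme states *)

Definition disjointness_preserving s :=
  forall a b, is_meet pea_le setT a b pzero -> s a = 0 \/ s b = 0.

(** In [1 = x + y = z + x], with [p x] and [q y] small, (RDP)_2 cuts [x] and [y]
    into [x = d1 + d2] and [y = d3 + d4] with [d2] and [d3] disjoint, so that
    [s], hence [p] and [q], vanishes on one of those. As [d1] and [d4] have the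
    same weight, what remains of [p 1] or of [q 1] is small. *)
Lemma disjointness_preserving_meet0 (hE : RDP2 E) s p q (k : R) :
    disjointness_preserving s -> positive_additive s ->
    positive_additive p -> positive_additive q ->
    (forall a, (p a : R) <= k * s a) -> (forall a, (q a : R) <= k * s a) ->
    additive_meet p q pone = 0 ->
  p pone = 0 \/ q pone = 0.
Proof.
move=> sdisj sP pP qP ps qs pq0.
have [p0 pD] := pP; have [q0 qD] := qP.
suff small (e : R) : 0 < e -> (p pone : R) < e \/ (q pone : R) < e.
  have [|p1] := eqVneq (p pone : R) 0; first by left.
  have [|q1] := eqVneq (q pone : R) 0; first by right.
  have p1_gt0 : 0 < (p pone : R) by rewrite lt_neqAle eq_sym p1; exact: p0.
  have q1_gt0 : 0 < (q pone : R) by rewrite lt_neqAle eq_sym q1; exact: q0.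
  have e0 : 0 < Num.min (p pone : R) (q pone : R) by rewrite lt_min p1_gt0.
  by have [] := small _ e0; rewrite lt_min ltxx ?andbF.
move=> e0.
have e2 : 0 < e / 2 by rewrite divr_gt0.
have [x [y [xy1 xyle]]] := additive_meet_ltP p q pone e2.
have [z [_ [zx1 _]]] := pconj xy1.
have [d1 [d2 [d3 [d4 [d12 d34 d13 d24 d23]]]]] := hE _ _ _ _ _ xy1 zx1.
move: xyle; rewrite pq0 add0r.
have := pD _ _ _ xy1; have := qD _ _ _ xy1.
have := pD _ _ _ d12; have := qD _ _ _ d12.
have := pD _ _ _ d34; have := qD _ _ _ d34.
have := pD _ _ _ d24; have := qD _ _ _ d24.
have := p0 d2; have := p0 d4; have := q0 d1; have := q0 d3.
have := p0 d1; have := q0 d4; have := q0 d2; have := p0 d3.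
have [s0|s0] := sdisj _ _ d23.
  by have := qs d2; rewrite s0 mulr0 => *; right; lra.
by have := ps d3; rewrite s0 mulr0 => *; left; lra.
Qed.

(** If [m] and [k *: s] have the same value at 1, their excesses over their meet
    are disjoint and have the same value at 1, so both are zero. *)
Lemma disjointness_preserving_scale (hE : RDP2 E) s m :
    disjointness_preserving s -> state_space R E s -> positive_additive m ->
    (forall a, (m a : R) <= s a) ->
  m = (m pone : R) *: s.
Proof.
move=> sdisj /stateP[sP s1] mP ms.
have [m0 _] := mP; have [s0 _] := sP.
set k := (m pone : R).
have k1 : k <= 1 by have := ms pone; rewrite s1.
have ksP : positive_additive (k *: s) by apply: positive_additiveZ => //; exact: m0.
set w := additive_meet m (k *: s).
have wP : positive_additive w by exact: additive_meetP.
have [w0 wD] := wP.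
have wm : forall a, (w a : R) <= m a := additive_meet_lel mP ksP.
have wks : forall a, (w a : R) <= k * s a := additive_meet_ler mP ksP.
have pP : positive_additive (m - w) by exact: positive_additiveB.
have qP : positive_additive (k *: s - w) by exact: positive_additiveB.
have p1q1 : (m - w) pone = (k *: s - w) pone.
  by rewrite !ptwsB ptwsZ s1 mulr1.
have p1 : (m - w) pone = 0.
  suff [|] : (m - w) pone = 0 \/ (k *: s - w) pone = 0 by rewrite ?p1q1.
  apply: (@disjointness_preserving_meet0 hE s _ _ 1) => // [a|a|].
  - by rewrite ptwsB mul1r; have := ms a; have := w0 a; lra.
  - rewrite ptwsB ptwsZ mul1r; have := w0 a.
    by have : k * s a <= 1 * s a by [exact: ler_wpM2r]; lra.
  apply/eqP; rewrite eq_le; apply/andP; split; last first.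
    exact: (proj1 (additive_meetP pP qP hE)).
  suff : (w pone + additive_meet (m - w) (k *: s - w) pone : R) <= w pone by lra.
  apply: le_additive_meet => x y xy1; rewrite (wD _ _ _ xy1).
  by have := additive_meet_le pP qP xy1; rewrite !ptwsB; lra.
have /subr0_eq mw := positive_additive_eq0 pP p1.
have /subr0_eq ksw : k *: s - w = 0 by apply: positive_additive_eq0; rewrite -?p1q1.
by rewrite mw ksw.
Qed.

Lemma disjointness_preserving_extreme (hE : RDP2 E) s :
  disjointness_preserving s -> state_space R E s ->
  extreme_points (state_space R E) s.
Proof.
move=> sdisj sS; split=> // y z t yS zS /andP[t0 t1] sE.
have part (k : R) u v : 0 < k -> k < 1 -> state_space R E u -> state_space R E v ->
    s = k *: u + (1 - k) *: v -> u = s.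
  move=> k0 k1 /stateP[uP u1] /stateP[vP v1] sE'.
  have ku : k *: u = ((k *: u) pone : R) *: s.
    apply: disjointness_preserving_scale => // [|a].
      by apply: positive_additiveZ => //; exact: ltW.
    rewrite [in leRHS]sE' ptwsD lerDl ptwsZ mulr_ge0//; first by lra.
    exact: (proj1 vP).
  move: ku; rewrite ptwsZ u1 mulr1.
  by apply: scalerI; rewrite gt_eqF.
split; first exact: (part t y z).
apply: (part (1 - t) z y) => //; [lra|lra|].
by rewrite sE addrC (_ : 1 - (1 - t) = t)//; lra.
Qed.

(** The component of [s] carried by the multiples of [a]: in a lattice-ordered
    group with order unit, [c |-> lim_n s (c /\ n a)]. *)
Definition carried_by s a : V :=
  fun c => sup [set r : R | exists x, [/\ sum_below a x, pea_le x c & r = s x]].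

Section carried_by.
Variables (s : V) (a : E).
Hypothesis sP : positive_additive s.

Lemma carried_by_ge x c : sum_below a x -> pea_le x c ->
  (s x : R) <= carried_by s a c.
Proof.
move=> ax xc; apply: ub_le_sup; last by exists x.
by exists (s c) => _ [y [_ yc ->]]; exact: positive_additive_le.
Qed.

Lemma carried_by_le (r : R) c :
  (forall x, sum_below a x -> pea_le x c -> (s x : R) <= r) ->
  (carried_by s a c : R) <= r.
Proof.
move=> rP; apply: ge_sup; last by move=> _ [x [ax xc ->]]; exact: rP.
exists (s pzero), pzero; split=> //; last by exists c; exact: padd0a.
by apply: sum_below_le; exists a; exact: padd0a.
Qed.

Lemma carried_byP (hE : RDP2 E) : positive_additive (carried_by s a).
Proof.
have [s0 sD] := sP; split=> [c|c d f cdf].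
  apply: le_trans (s0 pzero) _; apply: carried_by_ge.
    by apply: sum_below_le; exists a; exact: padd0a.
  by exists c; exact: padd0a.
apply/eqP; rewrite eq_le; apply/andP; split.
  apply: carried_by_le => x ax xf.
  have [x1 [x2 [x1c x2d x12]]] := RDP2_le_add hE cdf xf.
  rewrite (sD _ _ _ x12); apply: lerD; apply: carried_by_ge => //.
    by apply: sum_below_down ax _ => //; exists x2.
  by apply: sum_below_down ax _ => //; apply/pea_leP; exists x1.
rewrite -lerBrDr; apply: carried_by_le => x1 ax1 x1c.
rewrite lerBrDr -lerBrDl; apply: carried_by_le => x2 ax2 x2d.
have [x x12 xf] := pea_le_add x1c x2d cdf.
have := carried_by_ge (sum_below_add x12 ax1 ax2) xf.
by rewrite (sD _ _ _ x12); lra.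
Qed.

End carried_by.

(** If [s] is positive on both [a] and [b], then splitting off the component of
    [s] carried by [a], which vanishes at [b], shows that [s] is not extreme. *)
Lemma extreme_disjointness_preserving (hE : RDP2 E) s :
  extreme_points (state_space R E) s -> disjointness_preserving s.
Proof.
move=> [/stateP[sP s1] sext] a b ab0.
have [|sa] := eqVneq (s a : R) 0; first by left.
have [|sb] := eqVneq (s b : R) 0; first by right.
have [s0 _] := sP.
have sa_gt0 : 0 < (s a : R) by rewrite lt_neqAle eq_sym sa; exact: s0.
have sb_gt0 : 0 < (s b : R) by rewrite lt_neqAle eq_sym sb; exact: s0.
set m := carried_by s a.
have mP : positive_additive m by exact: carried_byP.
have ms c : (m c : R) <= s c.
  by apply: carried_by_le => x _; exact: positive_additive_le.
have ma : (s a : R) <= m a.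
  by apply: carried_by_ge => //; [apply: sum_below_le|]; exact: pea_le_refl.
have mb : m b = 0.
  apply/eqP; rewrite eq_le; apply/andP; split; last exact: (proj1 mP).
  apply: carried_by_le => x ax xb.
  by rewrite (sum_below_disjoint ab0 ax xb) positive_additive0.
have nP : positive_additive (s - m) by exact: positive_additiveB.
set t := (m pone : R).
have t0 : 0 < t.
  by have := positive_additive_le mP (pea_le1 a); rewrite -/t; lra.
have t1 : t < 1.
  have := positive_additive_le nP (pea_le1 b).
  by rewrite !ptwsB s1 mb -/t; lra.
have [||||mE _] := sext (t^-1 *: m) ((1 - t)^-1 *: (s - m)) t.
- apply/stateP; split; last by rewrite ptwsZ mulVf// gt_eqF.
  by apply: positive_additiveZ => //; rewrite invr_ge0 ltW.
- apply/stateP; split.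
    by apply: positive_additiveZ => //; rewrite invr_ge0; lra.
  by rewrite ptwsZ ptwsB s1 -/t mulVf// gt_eqF// subr_gt0.
- by rewrite t0.
- by rewrite !scalerA !divff ?gt_eqF ?subr_gt0// !scale1r addrC subrK.
by right; rewrite -mE ptwsZ mb mulr0.
Qed.

Lemma extreme_pointsE (hE : RDP2 E) : extreme_points (state_space R E) =
  state_space R E `&` disjointness_preserving.
Proof.
apply/seteqP; split=> s.
  by move=> sext; split; [case: sext|exact: extreme_disjointness_preserving].
by move=> [sS sdisj]; exact: disjointness_preserving_extreme.
Qed.

(** * Topology of the state space *)

Lemma ptws_hausdorff : hausdorff_space V.
Proof.
by apply: (@hausdorff_product {classic E} (fun=> R^o)) => _; exact: norm_hausdorff.
Qed.

Lemma closed_preimage_eval x (A : set R^o) :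
  closed A -> closed [set m : V | A (m x)].
Proof.
by apply: preimage_closed => m _; exact: ptws_eval_continuous.
Qed.

Lemma closed_disjointness_preserving :
  closed [set s : V | disjointness_preserving s].
Proof.
rewrite (_ : [set _ | _] =
    \bigcap_(ab in [set ab | is_meet pea_le setT ab.1 ab.2 pzero])
      ([set s : V | [set 0] (s ab.1)] `|` [set s : V | [set 0] (s ab.2)])).
  apply: closed_bigI => ab _; apply: closedU; apply: closed_preimage_eval;
    exact: closed_eq.
apply/seteqP; split=> s /= sdisj; first by move=> [a b]; exact: sdisj.
by move=> a b ab0; exact: (sdisj (a, b)).
Qed.

Lemma closed_additive a b c : closed [set s : V | s c = s a + s b].
Proof.
rewrite (_ : [set _ | _] = (fun s : V => s c - (s a + s b) : R^o) @^-1` [set 0]).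
  apply: preimage_closed; last exact: closed_eq.
  move=> s _.
  have ev x : (fun m : V => m x : R^o) @ s --> (s x : R^o).
    exact: ptws_eval_continuous.
  exact: (@cvgB _ _ _ _ _ _ _ _ _ (ev c) (@cvgD _ _ _ _ _ _ _ _ _ (ev a) (ev b))).
apply/seteqP; split=> s /=; first by move=> ->; rewrite subrr.
by move=> /subr0_eq.
Qed.

Lemma state_space_compact : compact (state_space R E).
Proof.
pose cube : set V := [set s | forall x, `[0, 1]%classic (s x : R)].
have cube_compact : compact cube.
  apply: (@tychonoff {classic E} (fun=> R^o) (fun=> `[0, 1]%classic)) => _.
  exact: segment_compact.
rewrite (_ : state_space R E = cube `&` ([set s : V | [set 1] (s pone)] `&`
    \bigcap_(t in [set t | padd t.1.1 t.1.2 = Some t.2])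
      [set s : V | s t.2 = s t.1.1 + s t.1.2])).
  apply: compact_closedI => //; apply: closedI.
    by apply: closed_preimage_eval; exact: closed_eq.
  by apply: closed_bigI => t _; exact: closed_additive.
apply/seteqP; split=> s.
  move=> [s01 sD s1]; split; first by move=> x; rewrite /= in_itv; exact: s01.
  by split=> // -[[a b] c]; exact: sD.
move=> [s01 [s1 sD]]; split=> [a|a b c abc|]; last exact: s1.
  by have := s01 a; rewrite /= in_itv.
exact: (sD (a, b, c)).
Qed.

Lemma state_space_bauer (hE : RDP2 E) : bauer_simplex (state_space R E).
Proof.
split; [exact: ptws_hausdorff|exact: state_space_simplex| |].
  exact: state_space_compact.
rewrite extreme_pointsE//; apply: compact_closedI.
  exact: state_space_compact.
exact: closed_disjointness_preserving.
Qed.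

End positive_additive.

Theorem theorem4p4 (R : realType) (E : pseudoEffectAlgebra) (hE : RDP2 E) :
  state_space R E = set0 \/
  (state_space R E !=set0 /\ bauer_simplex (state_space R E)).
Proof.
have [->|/set0P SN0] := eqVneq (state_space R E) set0; first by left.
by right; split=> //; exact: state_space_bauer.
Qed.
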